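(* Let $\vec r_1(t),\vec r_2(t),\vec r_3(t)$ be three points in the plane, $\vec r_i(t)=(x_i(t),y_i(t))$, moving along continuously differentiable curves so that at every moment of time, for each $i=1,2,3$ (indices mod $3$), the velocity $\dot{\vec r}_i$ is parallel to $\vec r_{i+1}-\vec r_{i+2}$, in the sense that $$(y_{i+1}-y_{i+2})\,\dot x_i-(x_{i+1}-x_{i+2})\,\dot y_i=0,\qquad i=1,2,3.$$ Then the triangle with vertices $\vec r_1(t),\vec r_2(t),\vec r_3(t)$ has the same area at every moment of time.
   Context: The stated constraint is called Rule B for the motion of three ''ants'' $\vec r_1,\vec r_2,\vec r_3$ in the plane. *)

(* Defs.v *)
From HB Require Import structures.
From mathcomp Require Import all_boot all_order all_algebra.
From mathcomp Require Import all_classical all_reals all_analysis.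

Set Implicit Arguments.
Unset Strict Implicit.
Unset Printing Implicit Defensive.

Import Order.TTheory GRing.Theory Num.Theory.
Import numFieldNormedType.Exports.

Local Open Scope classical_set_scope.
Local Open Scope ring_scope.

(* The difference quotient is restricted to s in I, s != t, so that at an
   endpoint belonging to I the derivative is the one-sided one. *)
Definition is_derive_within (R : realType) (I : set R) (f : R -> R)
    (t l : R) : Prop :=
  (f s - f t) / (s - t) @[s --> within I t^'] --> l.

Definition C1_on (R : realType) (I : set R) (f df : R -> R) : Prop :=
  (forall t, I t -> is_derive_within I f t (df t)) /\
  {within I, continuous df}.

(* Unsigned area: half the absolute value of the cross product of the sides
   b - a and c - a. It is 0 when the three points are collinear. *)
Definition triangle_area (R : realType) (a b c : R * R) : R :=
  `|(b.1 - a.1) * (c.2 - a.2) - (c.1 - a.1) * (b.2 - a.2)| / 2.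

(* Main.v *)
(* The signed area is a polynomial in the coordinates whose time derivative is
   half the sum of the three left-hand sides of Rule B. It therefore vanishes
   in the interior of the time interval, and the mean value theorem makes the
   signed area, hence its absolute value, constant. *)

Require Import Defs.
From HB Require Import structures.
From mathcomp Require Import all_boot all_order all_algebra.
From mathcomp Require Import all_classical all_reals all_analysis.
From mathcomp Require Import ring.

Set Implicit Arguments.
Unset Strict Implicit.
Unset Printing Implicit Defensive.

Import Order.TTheory GRing.Theory Num.Theory.
Import numFieldNormedType.Exports.

Local Open Scope classical_set_scope.
Local Open Scope ring_scope.

(** Near [t] membership in [A] is automatic, so the restricted limit is the full two-sided one; the
    substitution [s = h + t] then gives the increment form of the derivative. *)
Lemma is_derive_within_interior (R : realType) (A : set R) (f : R -> R)
    (t l : R) :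
  nbhs t A -> is_derive_within A f t l -> is_derive t 1 f l.
Proof.
move=> At ft.
(* Injectivity of the translation keeps [h + t] away from [t] when [h] is nonzero. *)
have shift0 : h + t @[h --> (0 : R)^'] --> t^'.
  have := @continuous_injective_withinNx R R (+%R^~ t) 0; rewrite add0r; apply.
    by rewrite /continuous_at; apply: cvgD; [exact: cvg_id | exact: cvg_cst].
  by move=> h; move/eqP; rewrite -subr_eq0 addrK => /eqP.
have ft' : (f s - f t) / (s - t) @[s --> t^'] --> l.
  move=> U /ft /= lU; rewrite !near_simpl /= in lU *.
  by apply: filterS2 (nbhs_dnbhs At) lU => s As; apply.
have dft : h^-1 *: ((f \o shift t) (h *: 1) - f t) @[h --> (0 : R)^'] --> l.
  have := cvg_comp _ _ shift0 ft'; apply: cvg_trans.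
  apply: near_eq_cvg; near=> h => /=.
  by rewrite addrK /GRing.scale /= mulr1 mulrC.
split; first by apply/cvg_ex; exists l.
exact: cvg_lim dft.
Unshelve. all: by end_near. Qed.

(** Write [f s] as the difference quotient times [s - t], plus [f t]: the product tends to
    [df t * 0]. *)
Lemma is_derive_within_continuous (R : realType) (A : set R) (f df : R -> R) :
  (forall t, A t -> is_derive_within A f t (df t)) ->
  {within A, continuous f}.
Proof.
move=> fdf; apply/subspace_continuousP => t At.
have st : s - t @[s --> within A t^'] --> (0 : R).
  rewrite -(subrr t); apply: cvgB; last exact: cvg_cst.
  by apply: cvg_trans (cvg_within _) _; exact: cvg_within.
have ft : (f s - f t) / (s - t) * (s - t) + f t @[s --> within A t^'] --> f t.
  rewrite -[X in _ --> X]add0r -(mulr0 (df t)).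
  by apply: cvgD; [apply: cvgM => //; exact: fdf | exact: cvg_cst].
move=> U ftU.
have ftU' : \forall s \near t, s != t -> A s ->
    U ((f s - f t) / (s - t) * (s - t) + f t) := ft U ftU.
suff : \forall s \near t, A s -> U (f s) by [].
apply: filterS ftU' => s sU As.
(* The limit [ft] ignores [s = t], where [U (f t)] holds because [U] is a neighbourhood of [f t]. *)
have [->|st0] := eqVneq s t; first exact: nbhs_singleton.
by have := sU st0 As; rewrite divfK ?subr_eq0// subrK.
Qed.

(** The mean value theorem needs the derivative only on the open segment between [s] and [t], whose
    points are interior to [I] even if [s] or [t] is an endpoint; continuity covers the ends. *)
Lemma is_derive0_interior_constant (R : realType) (I : interval R) (f : R -> R) :
  {within [set` I], continuous f} ->
  (forall t, nbhs t [set` I] -> is_derive t 1 f 0) ->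
  forall s t, s \in I -> t \in I -> f s = f t.
Proof.
move=> fc f0 s t; wlog st : s t / s <= t.
  by move=> H sI tI; case: (leP s t) => [|/ltW] st; [|apply/esym]; exact: H.
move=> sI tI.
have stI : `[s, t] `<=` [set` I].
  by move=> z /=; rewrite in_itv => /= szt; exact: interval_is_interval szt.
have [|_ _] := MVT_segment st _ (continuous_subspaceW stI fc) (df := fun=> 0).
  move=> z zst; apply: f0; apply: filterS (near_in_itvoo zst) => u ust.
  exact/stI/subset_itv_oo_cc.
by rewrite mul0r => /eqP; rewrite subr_eq0 => /eqP.
Qed.

Theorem proposition3p1 (R : realType) (I : interval R)
    (x y dx dy : 'Z_3 -> R -> R)
    (x_C1 : forall i, C1_on [set` I] (x i) (dx i))
    (y_C1 : forall i, C1_on [set` I] (y i) (dy i))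
    (ruleB : forall (i : 'Z_3) (t : R), t \in I ->
       (y (i + 1) t - y (i + 2) t) * dx i t
         - (x (i + 1) t - x (i + 2) t) * dy i t = 0) :
  forall s t : R, s \in I -> t \in I ->
    triangle_area (x 1 s, y 1 s) (x 2 s, y 2 s) (x 3 s, y 3 s) =
    triangle_area (x 1 t, y 1 t) (x 2 t, y 2 t) (x 3 t, y 3 t).
Proof.
move=> s t sI tI; rewrite /triangle_area /=; congr (`|_| / 2).
(* Twice the signed area, built with pointwise operations on functions so that the rules for
   continuity and derivatives apply directly. *)
pose D : R -> R := (x 2 - x 1) * (y 3 - y 1) - (x 3 - x 1) * (y 2 - y 1).
rewrite -[LHS]/(D s) -[RHS]/(D t).
have xc i := is_derive_within_continuous (x_C1 i).1.
have yc i := is_derive_within_continuous (y_C1 i).1.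
apply: is_derive0_interior_constant sI tI => [z|{}t tI].
  apply: continuousB; apply: continuousM; apply: continuousB;
    by [exact: xc | exact: yc].
have tI' : t \in I by exact: nbhs_singleton tI.
have x' i : is_derive t 1 (x i) (dx i t).
  exact: is_derive_within_interior ((x_C1 i).1 t tI').
have y' i : is_derive t 1 (y i) (dy i t).
  exact: is_derive_within_interior ((y_C1 i).1 t tI').
apply: (is_derive_eq (is_deriveB (is_deriveM (is_deriveB (x' 2) (x' 1))
    (is_deriveB (y' 3) (y' 1))) (is_deriveM (is_deriveB (x' 3) (x' 1))
    (is_deriveB (y' 2) (y' 1))))).
have := ruleB 1 t tI'; have := ruleB 2 t tI'; have := ruleB 3 t tI'.
(* Indices are reduced modulo 3, with [3] standing for the zero of ['Z_3]. *)
have -> : 3 + 1 = 1 :> 'Z_3 by exact/val_inj.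
have -> : 3 + 2 = 2 :> 'Z_3 by exact/val_inj.
have -> : 2 + 1 = 3 :> 'Z_3 by exact/val_inj.
have -> : 2 + 2 = 1 :> 'Z_3 by exact/val_inj.
have -> : 1 + 1 = 2 :> 'Z_3 by exact/val_inj.
have -> : 1 + 2 = 3 :> 'Z_3 by exact/val_inj.
(* The right-hand [0] is expanded into the sum of the three Rule B expressions, leaving a polynomial
   identity for [ring]. *)
move=> r3 r2 r1; rewrite -[RHS]addr0 -[X in _ = X + _]r1 -[X in _ = _ + X]addr0.
rewrite -[X in _ = _ + (X + _)]r2 -[X in _ = _ + (_ + X)]r3 /GRing.scale /=.
rewrite !fctE; ring.
Qed.
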